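(* Let $k$ be a field and let $f_1,\ldots,f_5\in k[x,y,z]$ be generic homogeneous forms of degree $2$. Then for every integer $s\ge 2$ the Hilbert series of $k[x,y,z]/(f_1,f_2,f_3,f_4,f_5)^s$ is $$\sum_{i=0}^{2s-1}\binom{i+2}{2}t^i .$$ Thus $(f_1,f_2,f_3,f_4,f_5)^s=(x,y,z)^{2s}$ for every $s\ge 2$.
   Context: The polynomial ring $k[x,y,z]$ has the standard grading, and the Hilbert series of a graded $k$-algebra $R=\bigoplus_{i\ge0}R_i$ is $\sum_{i\ge 0}\dim_k(R_i)\,t^i$. ''Generic'' has the usual meaning: there is a nonempty Zariski-open subset (defined over $k$) of the affine space of coefficients of $5$-tuples of quadratic forms in $x,y,z$ such that the assertion holds for all $(f_1,\ldots,f_5)$ whose coefficients lie in that subset. *)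

(* Defs.v *)
From HB Require Import structures.
From mathcomp Require Import all_boot all_order all_algebra.
From mathcomp Require Export mpoly.

Set Implicit Arguments.
Unset Strict Implicit.
Unset Printing Implicit Defensive.

Import GRing.Theory.
Local Open Scope ring_scope.

Section Ideals.
Variable R : comNzRingType.
Implicit Types (G I J : R -> Prop) (p : R).

Definition ideal_gen G p : Prop :=
  exists (n : nat) (a g : 'I_n -> R),
    (forall i, G (g i)) /\ p = \sum_(i < n) a i * g i.

Definition ideal_mul I J : R -> Prop :=
  ideal_gen (fun p => exists a b, I a /\ J b /\ p = a * b).

Fixpoint ideal_pow I (s : nat) : R -> Prop :=
  if s is s'.+1 then ideal_mul I (ideal_pow I s') else fun=> True.

End Ideals.

(* The quotient space V / (V :&: W) has dimension d: it has a basis consisting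
   of the classes of b_0, ..., b_(d-1) in V.  V and W are meant to be
   subspaces of M. *)
Definition quot_dim (k : fieldType) (M : lmodType k) (V W : M -> Prop)
    (d : nat) : Prop :=
  exists b : 'I_d -> M,
    [/\ forall j, V (b j),
        forall c : 'I_d -> k, W (\sum_(j < d) c j *: b j) -> forall j, c j = 0
      & forall v, V v -> exists c : 'I_d -> k, W (v - \sum_(j < d) c j *: b j)].

(* For a homogeneous ideal J of S = k[x_1, ..., x_n], the degree i component of
   S / J is S_i / (S_i :&: J).  A series is given by its coefficients. *)
Definition has_hilbert_series (k : fieldType) (n : nat)
    (J : {mpoly k[n]} -> Prop) (h : nat -> nat) : Prop :=
  forall i : nat, quot_dim (fun p : {mpoly k[n]} => p \is i.-homog) J (h i).

(* Open subsets of the affine space k^n for the Zariski topology: complements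
   of common zero loci of arbitrary sets of polynomials over k. *)
Definition zariski_open (k : fieldType) (n : nat) (U : 'rV[k]_n -> Prop) : Prop :=
  exists E : {mpoly k[n]} -> Prop,
    forall a : 'rV[k]_n, U a <-> exists p, E p /\ p.@[fun i => a 0 i] != 0.

(* Exponents of x^2, xy, xz, y^2, yz, z^2. *)
Definition quad_exponents : 6.-tuple 'X_{1..3} :=
  [tuple [multinom [tuple 2; 0; 0]]; [multinom [tuple 1; 1; 0]];
         [multinom [tuple 1; 0; 1]]; [multinom [tuple 0; 2; 0]];
         [multinom [tuple 0; 1; 1]]; [multinom [tuple 0; 0; 2]]]%N.

Definition quad_coeffs (k : fieldType) (f : 'I_5 -> {mpoly k[3]}) : 'rV[k]_(5 * 6) :=
  mxvec (\matrix_(i < 5, j < 6) (f i)@_(tnth quad_exponents j)).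

(* The nonempty open set is required to have a k-rational point, so that the
   notion is not vacuous when k is finite. *)
Definition for_generic_quadrics (k : fieldType)
    (Q : ('I_5 -> {mpoly k[3]}) -> Prop) : Prop :=
  exists U : 'rV[k]_(5 * 6) -> Prop,
    [/\ zariski_open U,
        exists a, U a
      & forall f : 'I_5 -> {mpoly k[3]},
          (forall i, f i \is 2.-homog) -> U (quad_coeffs f) -> Q f].

Definition ideal_of_family (k : fieldType) (n m : nat) (f : 'I_m -> {mpoly k[n]}) :
    {mpoly k[n]} -> Prop :=
  ideal_gen (fun p => exists i, p = f i).

Definition irrelevant_ideal (k : fieldType) (n : nat) : {mpoly k[n]} -> Prop :=
  ideal_of_family (fun i : 'I_n => 'X_i).

(* Main.v *)
Require Import Defs.
From mathcomp Require Import all_boot all_order all_algebra.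
From mathcomp Require Import ring.

Local Open Scope ring_scope.

Set Implicit Arguments.
Unset Strict Implicit.
Unset Printing Implicit Defensive.

Import GRing.Theory.

(** Let I be the ideal generated by five quadrics f_0, ..., f_4 in three
    variables, and m the irrelevant ideal.  There are 15 products f_i f_j and
    15 monomials of degree 4.  If the products span the forms of degree 4,
    then I^2 contains m^4, hence equals it.  No further genericity is needed
    for the higher powers [ideal_pow_of_square]: inductively
    m^(2s+2) = m^2 I^s = (m^2 I) I^(s-1), which is contained in
    m^4 I^(s-1) = I^2 I^(s-1) = I^(s+1).
    The power m^e consists of the polynomials all of whose monomials have
    degree at least e [irrelevant_powP], which gives the Hilbert series
    [hilbert_series_order_ge].

    That the products span is an open condition: it says that for some choice
    L of 15 combinations of the products, the determinant of their coefficient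
    matrix is nonzero, and for each L this determinant is a polynomial in the
    30 coefficients of the f_i [meval_univ_comb_det].  Ranging over all L
    avoids choosing an order on the products or removing the repetitions
    f_i f_j = f_j f_i.

    The open set has a rational point over every field, in any characteristic:
    the quadrics x^2 - y^2, y^2 - z^2, xy, xz, yz.  Each quartic monomial is
    an integral combination of their products [sample_quadric_span]; for
    instance (xy)^2 - (xz)^2 + (yz)^2 - (x^2 - y^2)(y^2 - z^2) = y^4. *)

(** * Powers of ideals *)

Section IdealPowers.
Variable R : comNzRingType.
Implicit Types (G I J : R -> Prop) (p q : R).

Lemma ideal_gen_incl G p : G p -> ideal_gen G p.
Proof.
by move=> Gp; exists 1%N, (fun=> 1), (fun=> p); rewrite big_ord1 mul1r.
Qed.

Lemma ideal_gen0 G : ideal_gen G 0.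
Proof.
by exists 0%N, (fun=> 0), (fun=> 0); rewrite big_ord0; split=> // -[].
Qed.

Lemma ideal_genD G p q : ideal_gen G p -> ideal_gen G q -> ideal_gen G (p + q).
Proof.
move=> [m [a [g [Gg ->]]]] [n [b [h [Gh ->]]]].
exists (m + n)%N, (fun i => match split i with inl j => a j | inr j => b j end),
  (fun i => match split i with inl j => g j | inr j => h j end).
split; first by move=> i; case: (split i).
rewrite big_split_ord; congr (_ + _); apply: eq_bigr => i _ /=.
  by rewrite (unsplitK (inl _ i)).
by rewrite (unsplitK (inr _ i)).
Qed.

Lemma ideal_genM G p q : ideal_gen G q -> ideal_gen G (p * q).
Proof.
move=> [n [a [g [Gg ->]]]]; exists n, (fun i => p * a i), g; split=> //.
by rewrite mulr_sumr; apply: eq_bigr => i _; rewrite mulrA.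
Qed.

Lemma ideal_pow0 I s : ideal_pow I s 0.
Proof. by case: s => //= s; apply: ideal_gen0. Qed.

Lemma ideal_powD I s p q :
  ideal_pow I s p -> ideal_pow I s q -> ideal_pow I s (p + q).
Proof. by case: s => //= s; apply: ideal_genD. Qed.

Lemma ideal_powM I s p q : ideal_pow I s q -> ideal_pow I s (p * q).
Proof. by case: s => //= s; apply: ideal_genM. Qed.

Lemma ideal_pow_sum (T : Type) (r : seq T) (P : pred T) (F : T -> R) I s :
  (forall i, P i -> ideal_pow I s (F i)) ->
  ideal_pow I s (\sum_(i <- r | P i) F i).
Proof.
move=> IF; elim/big_ind: _ => //; [exact: ideal_pow0 | exact: ideal_powD].
Qed.

Lemma ideal_powS I s p q : I p -> ideal_pow I s q -> ideal_pow I s.+1 (p * q).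
Proof. by move=> Ip Iq; apply: ideal_gen_incl; exists p, q. Qed.

Lemma ideal_powSP I s p : ideal_pow I s.+1 p ->
  exists (n : nat) (a b c : 'I_n -> R),
    (forall i, I (b i) /\ ideal_pow I s (c i))
    /\ p = \sum_(i < n) a i * (b i * c i).
Proof.
move=> [n [a [g [Gg ->]]]]; exists n, a.
have /fin_all_exists [bc bcP] : forall i, exists bc : R * R,
    [/\ I bc.1, ideal_pow I s bc.2 & g i = bc.1 * bc.2].
  by move=> i; have [b [c [? []]]] := Gg i; exists (b, c).
exists (fun i => (bc i).1), (fun i => (bc i).2); split.
  by move=> i; have [] := bcP i.
by apply: eq_bigr => i _; have [_ _ ->] := bcP i.
Qed.

Lemma ideal_pow_mul I s t p q :
  ideal_pow I s p -> ideal_pow I t q -> ideal_pow I (s + t) (p * q).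
Proof.
elim: s p => [|s IHs] p; first by move=> _; apply: ideal_powM.
move=> /ideal_powSP [n [a [b [c [bcP ->]]]]] Jq; rewrite addSn mulr_suml.
apply: ideal_pow_sum => i _; rewrite -!mulrA; apply: ideal_powM.
by have [Ib Jc] := bcP i; apply: ideal_powS => //; apply: IHs.
Qed.

End IdealPowers.

(** * Powers of the irrelevant ideal *)

(** The polynomial p has order at least e, that is, all its monomials have
    degree at least e. *)
Definition order_ge (R : nzRingType) (n e : nat) (p : {mpoly R[n]}) : Prop :=
  forall m, (mdeg m < e)%N -> p@_m = 0.

(** A monomial of degree at least d + e is the product of one of degree d and
    one of degree at least e. *)
Lemma mnm_split_deg n d e (m : 'X_{1..n}) : (d + e <= mdeg m)%N ->
  exists m1 m2, [/\ m = (m1 + m2)%MM, mdeg m1 = d & (e <= mdeg m2)%N].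
Proof.
elim: d e => [|d IHd] e le_m.
  by exists 0%MM, m; rewrite add0m mdeg0.
have [|m1 [m2 [-> <- lt_e]]] := IHd e.+1; first by rewrite addnS.
have [i m2i] : exists i, m2 i != 0%N.
  apply/existsP; apply: contraTT lt_e => /existsPn m2_0.
  rewrite mdegE big1 ?addSn // => i _.
  by move/(_ i): m2_0; rewrite negbK => /eqP.
have Ui_m2 : (U_(i) <= m2)%MM by rewrite lep1mP.
exists (m1 + U_(i))%MM, (m2 - U_(i))%MM; split.
- by rewrite -addmA [(U_(i) + _)%MM]addmC submK.
- by rewrite mdegD mdeg1 addn1.
by rewrite -(leq_add2r 1) -{2}(mdeg1 i) -mdegD submK // addn1.
Qed.

Section OrderGe.
Variables (k : fieldType) (n : nat).
Implicit Types (p q : {mpoly k[n]}) (I J : {mpoly k[n]} -> Prop).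

Lemma order_geX e m : (e <= mdeg m)%N -> order_ge e ('X_[m] : {mpoly k[n]}).
Proof.
move=> le_e m' lt_m'; rewrite mcoeffX; case: eqP => // eq_m.
by move: lt_m'; rewrite -eq_m ltnNge le_e.
Qed.

Lemma order_ge_sum (T : Type) (r : seq T) (F : T -> {mpoly k[n]}) e :
  (forall i, order_ge e (F i)) -> order_ge e (\sum_(i <- r) F i).
Proof.
by move=> oF m lt_m; rewrite raddf_sum big1 //= => i _; apply: oF.
Qed.

Lemma order_geM d e p q :
  order_ge d p -> order_ge e q -> order_ge (d + e) (p * q).
Proof.
move=> op oq m lt_m; rewrite mcoeffM big1 // => -[m1 m2] /= /eqP eq_m.
have {lt_m}: (mdeg m1 + mdeg m2 < d + e)%N by rewrite -mdegD -eq_m.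
have [lt1 _|le1] := ltnP (mdeg m1) d; first by rewrite op // mul0r.
have [lt2 _|le2] := ltnP (mdeg m2) e; first by rewrite oq // mulr0.
by rewrite ltnNge leq_add.
Qed.

Lemma dhomog_order_ge d p : p \is d.-homog -> order_ge d p.
Proof.
move=> hp m lt_m; apply: (dhomog_nemf_coeff hp).
by rewrite /= neq_ltn lt_m.
Qed.

Lemma order_ge_ideal_gen e (G : {mpoly k[n]} -> Prop) p :
  (forall g, G g -> order_ge e g) -> ideal_gen G p -> order_ge e p.
Proof.
move=> oG [r [a [g [Gg ->]]]]; apply: order_ge_sum => i.
by rewrite -[e]add0n; apply: order_geM => //; apply: oG.
Qed.

Lemma order_ge_ideal_pow d I s p :
  (forall g, I g -> order_ge d g) -> ideal_pow I s p -> order_ge (d * s) p.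
Proof.
move=> oI; elim: s p => [|s IHs] p; first by rewrite muln0.
rewrite mulnS; apply: order_ge_ideal_gen => _ [a [b [Ia [Jb ->]]]].
by apply: order_geM; [apply: oI | apply: IHs].
Qed.

(** An ideal power that contains the monomials of degree e contains every
    polynomial of order at least e. *)
Lemma ideal_pow_order_ge I s e p :
  (forall m, mdeg m = e -> ideal_pow I s 'X_[m]) ->
  order_ge e p -> ideal_pow I s p.
Proof.
move=> IX op; rewrite [p]mpolyE big_seq; apply: ideal_pow_sum => m.
rewrite mcoeff_msupp -mul_mpolyC => pm; apply: ideal_powM.
have le_m : (e + 0 <= mdeg m)%N.
  by rewrite addn0 leqNgt; apply: contraNN pm => /op ->.
have [m1 [m2 [-> d1 _]]] := mnm_split_deg le_m.
by rewrite mpolyXD mulrC; apply: ideal_powM; apply: IX.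
Qed.

Lemma irrelevant_powP e p :
  ideal_pow (@irrelevant_ideal k n) e p <-> order_ge e p.
Proof.
split=> [|op].
  rewrite -[X in order_ge X _]mul1n; apply: order_ge_ideal_pow => g.
  apply: order_ge_ideal_gen => _ [i ->].
  by apply: order_geX; rewrite mdeg1.
apply: ideal_pow_order_ge op; elim: e => [|e IHe] m dm //.
have le_m : (1 + e <= mdeg m)%N by rewrite dm.
have [m1 [m2 [def_m /eqP/mdeg1P [i /eqP m1E] _]]] := mnm_split_deg le_m.
rewrite def_m m1E mpolyXD; apply: ideal_powS.
  by apply: ideal_gen_incl; exists i.
apply: IHe; apply/eqP; move/eqP: dm.
by rewrite def_m m1E mdegD mdeg1 add1n eqSS.
Qed.

(** If the elements of an ideal I have order at least 2 and I^2 contains the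
    quartic monomials, then I^s is the 2s-th power of the irrelevant ideal for
    every s >= 2. *)
Lemma ideal_pow_of_square I s p :
    (forall g, I g -> order_ge 2 g) ->
    (forall m, mdeg m = 4 -> ideal_pow I 2 'X_[m]) -> (2 <= s)%N ->
  (ideal_pow I s p <-> order_ge (2 * s) p).
Proof.
move=> oI IX le2s; split; first exact: order_ge_ideal_pow.
apply: ideal_pow_order_ge; case: s le2s => [|[|s]] // _.
elim: s => [|s IHs] m dm; first exact: IX.
have le_m : (2 + 2 * s.+2 <= mdeg m)%N by rewrite dm [in leqRHS]mulnS.
have [m1 [m2 [def_m d1 _]]] := mnm_split_deg le_m.
have d2 : mdeg m2 = (2 * s.+2)%N.
  by apply/eqP; rewrite -(eqn_add2l 2) -{1}d1 -mdegD -def_m dm mulnS.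
rewrite def_m mpolyXD.
have /ideal_powSP [r [a [b [c [bcP ->]]]]] := IHs m2 d2.
rewrite mulr_sumr; apply: ideal_pow_sum => i _; have [Ib Jc] := bcP i.
(* The factor b i absorbs the quadratic monomial m1, which puts it in I^2. *)
have -> : 'X_[m1] * (a i * (b i * c i)) = a i * ('X_[m1] * b i * c i) by ring.
apply: ideal_powM; apply: (@ideal_pow_mul _ I 2 s.+1) => //.
apply: (ideal_pow_order_ge IX); apply: (@order_geM 2 2); last exact: oI.
by apply: order_geX; rewrite d1.
Qed.

End OrderGe.

(** * Forms of a given degree *)

(** An enumeration of the monomials of degree d in n + 1 variables, of which
    there are C(d + n, d); the default value of [nth] is never reached. *)
Definition deg_mnm n d (i : 'I_('C(d + n, d))) : 'X_{1..n.+1} :=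
  nth 0%MM [seq s2m (tval t) | t : d.-tuple 'I_n.+1 <- enum (basis n.+1 d)] i.

Arguments deg_mnm n d i : clear implicits.

Lemma deg_mnm_inj n d : injective (deg_mnm n d).
Proof.
move=> i j /eqP; rewrite nth_uniq ?mpoly.size_basis ?uniq_basis //.
by move/eqP/val_inj.
Qed.

Lemma mdeg_deg_mnm n d i : mdeg (deg_mnm n d i) = d.
Proof. by apply/eqP; rewrite basis_cover mem_nth // mpoly.size_basis. Qed.

Lemma deg_mnmP n d (m : 'X_{1..n.+1}) :
  mdeg m = d -> exists i, m = deg_mnm n d i.
Proof.
move/eqP; rewrite basis_cover => /(nthP 0%MM) [i lt_i <-].
by rewrite mpoly.size_basis in lt_i; exists (Ordinal lt_i).
Qed.

Lemma mcoeff_deg_mnm (R : nzRingType) n d (c : 'I_('C(d + n, d)) -> R) i :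
  (\sum_j c j *: 'X_[deg_mnm n d j] : {mpoly R[n.+1]})@_(deg_mnm n d i) = c i.
Proof.
rewrite raddf_sum (bigD1 i) //= mcoeffZ mcoeffX eqxx mulr1 big1 ?addr0 //.
move=> j ne_ji.
by rewrite mcoeffZ mcoeffX (inj_eq (@deg_mnm_inj _ _)) (negPf ne_ji) mulr0.
Qed.

Lemma dhomog_sum_deg_mnm (R : nzRingType) n d (p : {mpoly R[n.+1]}) :
  p \is d.-homog ->
  p = \sum_(i < 'C(d + n, d)) p@_(deg_mnm n d i) *: 'X_[deg_mnm n d i].
Proof.
move=> hp; apply/mpolyP => m; have [/deg_mnmP [i ->]|ne_m] := eqVneq (mdeg m) d.
  by rewrite mcoeff_deg_mnm.
rewrite (dhomog_nemf_coeff hp) // raddf_sum big1 //= => i _.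
rewrite mcoeffZ mcoeffX; case: eqP => [def_m|_]; last by rewrite mulr0.
by rewrite -def_m mdeg_deg_mnm eqxx in ne_m.
Qed.

(** The classes of the monomials of degree i < e are a basis of the degree i
    part of the quotient by the polynomials of order at least e. *)
Lemma hilbert_series_order_ge (k : fieldType) n e (J : {mpoly k[n.+1]} -> Prop)
    (h : nat -> nat) :
    (forall p, J p <-> order_ge e p) ->
    (forall i, h i = if (i < e)%N then 'C(i + n, i) else 0%N) ->
  has_hilbert_series J h.
Proof.
move=> JE hE i; rewrite hE; case: ltnP => [lt_ie|le_ei].
  exists (fun j => 'X_[deg_mnm n i j]); split.
  - by move=> j; rewrite dhomogX /= mdeg_deg_mnm.
  - move=> c /JE oc j; rewrite -(mcoeff_deg_mnm c j); apply: oc.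
    by rewrite mdeg_deg_mnm.
  move=> v hv; exists (fun j => v@_(deg_mnm n i j)); apply/JE => m _.
  by rewrite -(dhomog_sum_deg_mnm hv) subrr mcoeff0.
exists (fun=> 0); split=> [[]|c _ []|v hv] //.
exists (fun=> 0); rewrite big_ord0 subr0; apply/JE => m lt_me.
by apply: (dhomog_order_ge hv); apply: leq_trans le_ei.
Qed.

(** If the coefficient matrix of as many forms of degree d as there are
    monomials is invertible, then these forms span all monomials. *)
Lemma mnm_in_form_span (k : fieldType) n d
    (g : 'I_('C(d + n, d)) -> {mpoly k[n.+1]}) :
    (forall i, g i \is d.-homog) ->
    \det (\matrix_(i, j) (g i)@_(deg_mnm n d j)) != 0 ->
  forall i, exists c : 'I_('C(d + n, d)) -> k,
    'X_[deg_mnm n d i] = \sum_j c j *: g j.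
Proof.
move=> hg; set A := \matrix_(_, _) _ => detA i.
have uA : A \in unitmx by rewrite unitmxE unitfE.
exists (fun j => invmx A i j).
have hX : ('X_[deg_mnm n d i] : {mpoly k[n.+1]}) \is d.-homog.
  by rewrite dhomogX /= mdeg_deg_mnm.
have hS : \sum_j invmx A i j *: g j \is d.-homog.
  by apply: rpred_sum => j _; apply: rpredZ.
rewrite (dhomog_sum_deg_mnm hX) (dhomog_sum_deg_mnm hS).
apply: eq_bigr => j _; congr (_ *: _); rewrite raddf_sum /=.
have /matrixP/(_ i j) := mulVmx uA; rewrite !mxE => def_ij.
rewrite mcoeffX (inj_eq (@deg_mnm_inj _ _)) -def_ij.
by apply: eq_bigr => j' _; rewrite mcoeffZ [A _ _]mxE.
Qed.

(** * The span of the pairwise products of a family of polynomials *)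

Section ProdSpan.
Variables (k : fieldType) (n r : nat).
Implicit Types (f : 'I_r -> {mpoly k[n]}) (l : 'M[k]_r) (p q : {mpoly k[n]}).

(** The combination of the products f_i f_j with coefficient matrix l. *)
Definition prod_comb f l : {mpoly k[n]} := \sum_i \sum_j l i j *: (f i * f j).

(** Membership in the k-linear span of the products f_i f_j. *)
Definition prod_span f p : Prop := exists l, p = prod_comb f l.

Lemma prod_span0 f : prod_span f 0.
Proof.
exists 0; rewrite /prod_comb big1 // => i _; rewrite big1 // => j _.
by rewrite mxE scale0r.
Qed.

Lemma prod_spanD f p q : prod_span f p -> prod_span f q -> prod_span f (p + q).
Proof.
move=> [l ->] [l' ->]; exists (l + l').
rewrite -big_split; apply: eq_bigr => i _.
by rewrite -big_split; apply: eq_bigr => j _; rewrite mxE scalerDl.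
Qed.

Lemma prod_spanZ f c p : prod_span f p -> prod_span f (c *: p).
Proof.
move=> [l ->]; exists (c *: l); rewrite scaler_sumr; apply: eq_bigr => i _.
by rewrite scaler_sumr; apply: eq_bigr => j _; rewrite mxE scalerA.
Qed.

Lemma prod_spanB f p q : prod_span f p -> prod_span f q -> prod_span f (p - q).
Proof. by move=> fp fq; rewrite -scaleN1r; apply/prod_spanD/prod_spanZ. Qed.

Lemma prod_span_sum f (T : Type) (s : seq T) (F : T -> {mpoly k[n]}) :
  (forall i, prod_span f (F i)) -> prod_span f (\sum_(i <- s) F i).
Proof.
move=> fF; elim/big_ind: _ => //; [exact: prod_span0 | exact: prod_spanD].
Qed.

Lemma prod_span_mul f i j : prod_span f (f i * f j).
Proof.
exists (delta_mx i j); rewrite /prod_comb (bigD1 i) //= (bigD1 j) //=.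
rewrite mxE !eqxx scale1r big1 ?addr0 => [|j' /negPf ne_j]; last first.
  by rewrite mxE ne_j andbF scale0r.
rewrite big1 ?addr0 // => i' /negPf ne_i; rewrite big1 // => j' _.
by rewrite mxE ne_i scale0r.
Qed.

Lemma prod_span_ideal_pow f p :
  prod_span f p -> ideal_pow (ideal_of_family f) 2 p.
Proof.
move=> [l ->]; apply: ideal_pow_sum => i _; apply: ideal_pow_sum => j _.
have If a : ideal_of_family f (f a) by apply: ideal_gen_incl; exists a.
rewrite -mul_mpolyC; apply: ideal_powM; apply: ideal_powS => //.
by rewrite -[f j]mulr1; apply: ideal_powS.
Qed.

Lemma prod_comb_dhomog f l d :
  (forall i, f i \is d.-homog) -> prod_comb f l \is (d + d).-homog.
Proof.
move=> hf; apply: rpred_sum => i _; apply: rpred_sum => j _.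
by apply: rpredZ; apply: dhomogM.
Qed.

End ProdSpan.

(** * Monomials in three variables *)

Lemma mnm3E (m : 'X_{1..3}) : m = [multinom [tuple m 0; m 1; m 2%:R]].
Proof.
apply/mnmP => i; rewrite [RHS](mnm_nth 0%N) /=.
by case: i => [[|[|[|]]] lti] //=; congr (m _); apply: val_inj.
Qed.

Lemma mdeg3E (m : 'X_{1..3}) : mdeg m = (m 0%R + m 1%R + m 2%:R%R)%N.
Proof.
rewrite mdegE !big_ord_recr big_ord0 /= add0n.
by congr (m _ + m _ + m _)%N; apply: val_inj.
Qed.

Lemma mpolyX3E (R : nzRingType) (m : 'X_{1..3}) : 'X_[m] =
  'X_0 ^+ m 0 * 'X_1 ^+ m 1 * 'X_2%:R ^+ m 2%:R :> {mpoly R[3]}.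
Proof.
rewrite mpolyXE_id !big_ord_recr big_ord0 /= mul1r.
by congr ('X_ _ ^+ m _ * 'X_ _ ^+ m _ * 'X_ _ ^+ m _); apply: val_inj.
Qed.

Lemma quad_exponentsP (m : 'X_{1..3}) :
  mdeg m = 2 -> exists t, m = tnth quad_exponents t.
Proof.
move=> dm; suff /(nthP 0%MM) [t lt_t <-] : m \in quad_exponents.
  by exists (Ordinal lt_t); rewrite (tnth_nth 0%MM).
move: dm; rewrite mdeg3E [in X in _ -> X](mnm3E m).
move: (m 0) (m 1) (m 2%:R) => [|[|[|?]]] [|[|[|?]]] [|[|[|?]]] // _.
all: by rewrite !inE eqxx ?orbT.
Qed.

Lemma mdeg_quad_exponents t : mdeg (tnth quad_exponents t) = 2.
Proof.
by case: t => [[|[|[|[|[|[|]]]]]] lti] //; rewrite /mdeg /= !big_cons big_nil.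
Qed.

Lemma quad_exponents_inj : injective (tnth quad_exponents).
Proof. exact/tuple_uniqP. Qed.

Lemma quadric_sum (R : nzRingType) (p : {mpoly R[3]}) : p \is 2.-homog ->
  p = \sum_(t < 6) p@_(tnth quad_exponents t) *: 'X_[tnth quad_exponents t].
Proof.
move=> hp; apply/mpolyP => m; rewrite raddf_sum /=.
have [/quad_exponentsP [t ->]|ne_m] := eqVneq (mdeg m) 2.
  rewrite (bigD1 t) //= mcoeffZ mcoeffX eqxx mulr1 big1 ?addr0 // => u ne_ut.
  by rewrite mcoeffZ mcoeffX (inj_eq quad_exponents_inj) (negPf ne_ut) mulr0.
rewrite (dhomog_nemf_coeff hp) // big1 // => t _.
rewrite mcoeffZ mcoeffX; case: eqP => [def_m|_]; last by rewrite mulr0.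
by rewrite -def_m mdeg_quad_exponents eqxx in ne_m.
Qed.

(** A predicate that holds of the fifteen quartic monomials in x, y, z, each
    written without trivial factors, holds of x^a y^b z^c if a + b + c = 4. *)
Lemma ternary_quartic_cases (R : comNzRingType) (S : R -> Prop) (x y z : R) :
    S (x ^+ 4) -> S (y ^+ 4) -> S (z ^+ 4) ->
    S (x ^+ 3 * y) -> S (x ^+ 3 * z) -> S (x * y ^+ 3) ->
    S (x * z ^+ 3) -> S (y ^+ 3 * z) -> S (y * z ^+ 3) ->
    S (x ^+ 2 * y ^+ 2) -> S (x ^+ 2 * z ^+ 2) -> S (y ^+ 2 * z ^+ 2) ->
    S (x ^+ 2 * y * z) -> S (x * y ^+ 2 * z) -> S (x * y * z ^+ 2) ->
  forall a b c : nat, (a + b + c)%N = 4 -> S (x ^+ a * y ^+ b * z ^+ c).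
Proof.
move=> x4 y4 z4 x3y x3z xy3 xz3 y3z yz3 x2y2 x2z2 y2z2 x2yz xy2z xyz2 a b c.
case: a => [|[|[|[|[|?]]]]]; case: b => [|[|[|[|[|?]]]]];
  by case: c => [|[|[|[|[|?]]]]] // _; rewrite ?expr0 ?expr1 ?mul1r ?mulr1.
Qed.

(** * Generic quadrics *)

Section Generic.
Variable k : fieldType.
Implicit Types (f : 'I_5 -> {mpoly k[3]}) (L : 'I_('C(4 + 2, 4)) -> 'M[k]_5).

(** The determinant of the coefficient matrix of the 15 combinations of the
    products f_i f_j given by L, on the quartic monomials. *)
Definition comb_det f L : k :=
  \det (\matrix_(i, j) (prod_comb f (L i))@_(deg_mnm 2 4 j)).

(** The universal quadrics, whose coefficients are the 30 variables, in the
    order in which [quad_coeffs] lists the coefficients of five quadrics. *)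
Definition univ_quadric (i : 'I_5) : {mpoly {mpoly k[5 * 6]}[3]} :=
  \sum_(t < 6) 'X_(mxvec_index i t) *: 'X_[tnth quad_exponents t].

(** The determinant [comb_det] of the universal quadrics, a polynomial in
    their coefficients. *)
Definition univ_comb_det L : {mpoly k[5 * 6]} :=
  \det (\matrix_(i, j) (\sum_a \sum_b
    (L i a b)%:MP * (univ_quadric a * univ_quadric b)@_(deg_mnm 2 4 j))).

(** Five quadrics are the specialization of the universal ones at their
    coefficients. *)
Lemma map_univ_quadric f i : f i \is 2.-homog ->
  map_mpoly (meval (fun j => quad_coeffs f 0 j)) (univ_quadric i) = f i.
Proof.
move=> hf; rewrite [RHS](quadric_sum hf) raddf_sum; apply: eq_bigr => t _ /=.
by rewrite map_mpolyZ map_mpolyX /= mevalXU mxvecE mxE.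
Qed.

Lemma meval_univ_comb_det f L : (forall i, f i \is 2.-homog) ->
  (univ_comb_det L).@[fun j => quad_coeffs f 0 j] = comb_det f L.
Proof.
move=> hf; rewrite -det_map_mx; congr (\det _); apply/matrixP => i j.
rewrite !mxE.
rewrite /prod_comb !raddf_sum; apply: eq_bigr => a _ /=.
rewrite !raddf_sum; apply: eq_bigr => b _ /=.
rewrite mevalM mevalC mcoeffZ -mcoeff_map_mpoly rmorphM /=.
by rewrite !map_univ_quadric.
Qed.

(** The next two lemmas say that the products of five quadrics span all
    quartic forms exactly when some [comb_det] is nonzero. *)
Lemma comb_det_span f L : (forall i, f i \is 2.-homog) -> comb_det f L != 0 ->
  forall m, mdeg m = 4 -> prod_span f 'X_[m].
Proof.
move=> hf detL m /deg_mnmP [i ->].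
have hg j : prod_comb f (L j) \is 4.-homog by apply: (prod_comb_dhomog _ hf).
have [c ->] := mnm_in_form_span hg detL i.
by apply: prod_span_sum => j; apply: prod_spanZ; exists (L j).
Qed.

Lemma span_comb_det f : (forall m, mdeg m = 4 -> prod_span f 'X_[m]) ->
  exists L, comb_det f L != 0.
Proof.
move=> fX.
have /fin_all_exists [L LE] : forall i : 'I_('C(4 + 2, 4)), exists l,
    'X_[deg_mnm 2 4 i] = prod_comb f l by move=> i; apply/fX/mdeg_deg_mnm.
(* The combinations are chosen to be the monomials themselves. *)
exists L; rewrite /comb_det [X in \det X](_ : _ = 1%:M) ?det1 ?oner_neq0 //.
apply/matrixP => i j.
by rewrite !mxE -LE mcoeffX (inj_eq (@deg_mnm_inj _ _)).
Qed.

(** The five quadrics x^2 - y^2, y^2 - z^2, xy, xz, yz, a rational point of the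
    open set over every field. *)
Definition sample_quadric (i : 'I_5) : {mpoly k[3]} :=
  let x := 'X_0 in let y := 'X_1 in let z := 'X_2%:R in
  [tuple x ^+ 2 - y ^+ 2; y ^+ 2 - z ^+ 2; x * y; x * z; y * z]`_i.

Lemma sample_quadric_homog i : sample_quadric i \is 2.-homog.
Proof.
have hX (a : 'I_3) : ('X_a : {mpoly k[3]}) \is 1.-homog.
  by rewrite dhomogX /= mdeg1.
have hXX (a b : 'I_3) : ('X_a * 'X_b : {mpoly k[3]}) \is 2.-homog.
  exact: (dhomogM (hX a) (hX b)).
by case: i => [[|[|[|[|[|]]]]] lti] //=; rewrite ?rpredB ?expr2 ?hXX.
Qed.

Local Notation spanned := (prod_span sample_quadric).

Lemma sample_quadric_span m : mdeg m = 4 -> spanned 'X_[m].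
Proof.
set x : {mpoly k[3]} := 'X_0; set y : {mpoly k[3]} := 'X_1.
set z : {mpoly k[3]} := 'X_2%:R.
pose a := x ^+ 2 - y ^+ 2; pose b := y ^+ 2 - z ^+ 2.
pose c := x * y; pose d := x * z; pose e := y * z.
have Sp i j : spanned (sample_quadric i * sample_quadric j).
  exact: prod_span_mul.
have aa : spanned (a * a) := Sp 0 0.
have ab : spanned (a * b) := Sp 0 1.
have ac : spanned (a * c) := Sp 0 2%:R.
have ad : spanned (a * d) := Sp 0 3%:R.
have ae : spanned (a * e) := Sp 0 4%:R.
have bb : spanned (b * b) := Sp 1 1.
have bc : spanned (b * c) := Sp 1 2%:R.
have bd : spanned (b * d) := Sp 1 3%:R.
have be : spanned (b * e) := Sp 1 4%:R.
have cc : spanned (c * c) := Sp 2%:R 2%:R.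
have cd : spanned (c * d) := Sp 2%:R 3%:R.
have ce : spanned (c * e) := Sp 2%:R 4%:R.
have dd : spanned (d * d) := Sp 3%:R 3%:R.
have de : spanned (d * e) := Sp 3%:R 4%:R.
have ee : spanned (e * e) := Sp 4%:R 4%:R.
have x2y2 : spanned (x ^+ 2 * y ^+ 2) by rewrite -exprMn.
have x2z2 : spanned (x ^+ 2 * z ^+ 2) by rewrite -exprMn.
have y2z2 : spanned (y ^+ 2 * z ^+ 2) by rewrite -exprMn.
have x2yz : spanned (x ^+ 2 * y * z).
  by have -> : x ^+ 2 * y * z = c * d by rewrite /c /d; ring.
have xy2z : spanned (x * y ^+ 2 * z).
  by have -> : x * y ^+ 2 * z = c * e by rewrite /c /e; ring.
have xyz2 : spanned (x * y * z ^+ 2).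
  by have -> : x * y * z ^+ 2 = d * e by rewrite /d /e; ring.
have y4 : spanned (y ^+ 4).
  have -> : y ^+ 4 = c * c - d * d + e * e - a * b.
    by rewrite /a /b /c /d /e; ring.
  by apply/prod_spanB => //; apply/prod_spanD => //; apply/prod_spanB.
have x4 : spanned (x ^+ 4).
  have -> : x ^+ 4 = a * a + c * c + c * c - y ^+ 4 by rewrite /a /c; ring.
  by apply/prod_spanB => //; do 2!apply/prod_spanD => //.
have z4 : spanned (z ^+ 4).
  have -> : z ^+ 4 = b * b + e * e + e * e - y ^+ 4 by rewrite /b /e; ring.
  by apply/prod_spanB => //; do 2!apply/prod_spanD => //.
have y3z : spanned (y ^+ 3 * z).
  have -> : y ^+ 3 * z = c * d - a * e by rewrite /a /c /d /e; ring.
  exact: prod_spanB.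
have x3z : spanned (x ^+ 3 * z).
  have -> : x ^+ 3 * z = a * d + c * e by rewrite /a /c /d /e; ring.
  exact: prod_spanD.
have xy3 : spanned (x * y ^+ 3).
  have -> : x * y ^+ 3 = b * c + d * e by rewrite /b /c /d /e; ring.
  exact: prod_spanD.
have x3y : spanned (x ^+ 3 * y).
  have -> : x ^+ 3 * y = a * c + x * y ^+ 3 by rewrite /a /c; ring.
  exact: prod_spanD.
have xz3 : spanned (x * z ^+ 3).
  have -> : x * z ^+ 3 = c * e - b * d by rewrite /b /c /d /e; ring.
  exact: prod_spanB.
have yz3 : spanned (y * z ^+ 3).
  have -> : y * z ^+ 3 = y ^+ 3 * z - b * e by rewrite /b /e; ring.
  exact: prod_spanB.
rewrite mdeg3E mpolyX3E -/x -/y -/z.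
exact: ternary_quartic_cases.
Qed.

End Generic.

Theorem theorem11 (k : fieldType) :
  for_generic_quadrics (fun f : 'I_5 -> {mpoly k[3]} =>
    forall s : nat, (2 <= s)%N ->
      has_hilbert_series (ideal_pow (ideal_of_family f) s)
        (fun i => (\sum_(0 <= j < 2 * s) 'C(j + 2, 2) *: 'X^j : {poly nat})`_i)
      /\ (forall p : {mpoly k[3]},
            ideal_pow (ideal_of_family f) s p <->
            ideal_pow (@irrelevant_ideal k 3) (2 * s) p)).
Proof.
pose E (p : {mpoly k[5 * 6]}) := exists L, p = univ_comb_det L.
exists (fun a => exists p, E p /\ p.@[fun i => a 0 i] != 0); split.
- by exists E.
- have [L detL] := span_comb_det (@sample_quadric_span k).
  exists (quad_coeffs (@sample_quadric k)), (univ_comb_det L).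
  split; first by exists L.
  by rewrite meval_univ_comb_det //; apply: sample_quadric_homog.
move=> f hf [_ [[L ->]]]; rewrite meval_univ_comb_det // => detL s le2s.
have I2X m : mdeg m = 4 -> ideal_pow (ideal_of_family f) 2 'X_[m].
  by move/(comb_det_span hf detL)/prod_span_ideal_pow.
have oI g : ideal_of_family f g -> order_ge 2 g.
  by apply: order_ge_ideal_gen => _ [i ->]; apply: dhomog_order_ge.
(* Both ideals are the set of polynomials of order at least 2s. *)
have IsE p : ideal_pow (ideal_of_family f) s p <-> order_ge (2 * s) p.
  exact: ideal_pow_of_square.
split=> [|p]; last by rewrite IsE irrelevant_powP.
apply: (hilbert_series_order_ge IsE) => i.
rewrite coef_sum big_mkord; case: ltnP => [lt_i|le_i].
  rewrite (bigD1 (Ordinal lt_i)) //= coefZ coefXn eqxx mulr1 big1 ?addr0.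
    by rewrite -bin_sub ?leq_addl // addnK.
  move=> j ne_ji; rewrite coefZ coefXn; case: eqP => [eq_ij|_]; last first.
    exact: mulr0.
  by case/eqP: ne_ji; apply: val_inj.
rewrite big1 // => j _; rewrite coefZ coefXn gtn_eqF ?mulr0 //.
exact: leq_trans le_i.
Qed.
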